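(* Let $r\ge 2$, $d\ge 2$, and let $(\mathcal{H}_1,\mathcal{H}_2,\dots,\mathcal{H}_d)$ be a $d$-partition of $K_{rd}^r$. The following are equivalent: (1) $det^{S^r}(\omega_{(\mathcal{H}_1,\mathcal{H}_2,\dots,\mathcal{H}_d)})\neq 0$. (2) $(\mathcal{H}_1,\mathcal{H}_2,\dots,\mathcal{H}_d)$ is pre-homogeneous, and $b_q(\mathcal{H}_i)=0$ for every $1\leq i\leq d$ and $-1\leq q\leq r-1$. (3) $(\mathcal{H}_1,\mathcal{H}_2,\dots,\mathcal{H}_d)$ is pre-homogeneous, and $b_{r-1}(\mathcal{H}_i)=0$ for every $1\leq i\leq d$.
   Context: $k$ is a field of characteristic zero, $\otimes=\otimes_k$, and $V_d$ is a $k$-vector space of dimension $d$ with basis $\{e_1,\dots,e_d\}$. Definition of $det^{S^r}$ ($r\ge 2$). Given $v_{i_1,\dots,i_r}\in V_d$ for $1\leq i_1<\dots<i_r\leq rd$, for each $1\leq m_1<\dots<m_{r-1}\leq rd$ let $\mathcal{E}_{m_1,\dots,m_{r-1}}$ be the vector equation (with scalar unknowns $\lambda_{i_1,\dots,i_r}$) $$\sum_{j=0}^{r-1}\ \sum_{m_j<s<m_{j+1}}(-1)^{(s-1)+j}\lambda_{m_1,\dots,m_j,s,m_{j+1},\dots,m_{r-1}}\,v_{m_1,\dots,m_j,s,m_{j+1},\dots,m_{r-1}}=0,$$ where $m_0=0$ and $m_r=rd+1$. In the basis $e_1,\dots,e_d$ each such equation is a block of $d$ scalar linear equations. Let $A_{rd}((v_{i_1,\dots,i_r}))$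 be the $d\binom{rd-1}{r-1}\times d\binom{rd-1}{r-1}$ coefficient matrix of the system of the equations $\mathcal{E}_{m_1,\dots,m_{r-1}}$ with $1\leq m_1<\dots<m_{r-1}<rd$ (columns indexed by $(i_1,\dots,i_r)$, row blocks by $(m_1,\dots,m_{r-1})$, in lexicographic order; note $\binom{rd}{r}=d\binom{rd-1}{r-1}$). Then $det^{S^r}:V_d^{\otimes\binom{rd}{r}}\to k$ is the linear map with $det^{S^r}(\otimes_{1\le i_1<\dots<i_r\le rd}(v_{i_1,\dots,i_r}))=\det(A_{rd}((v_{i_1,\dots,i_r})))$. Hypergraphs. $K_{n}^r$ is the complete $r$-uniform hypergraph with vertex set $\{1,\dots,n\}$, whose hyperedges are all $r$-element subsets. A $d$-partition of $K_{rd}^r$ is an ordered tuple $(\mathcal{H}_1,\dots,\mathcal{H}_d)$ of sub-hypergraphs, each with vertex set $\{1,\dots,rd\}$, whose hyperedge sets $E(\mathcal{H}_i)$ are pairwise disjoint with union the set of all hyperedges of $K_{rd}^r$. The element $\omega_{(\mathcal{H}_1,\dots,\mathcal{H}_d)}\in V_d^{\otimes\binom{rd}{r}}$ is the simple tensor $\otimes(v_{i_1,\dots,i_r})$ with $v_{i_1,\dots,i_r}=e_q$ where $q$ is the unique index with $\{i_1,\dots,i_r\}\in E(\mathcal{H}_q)$. For a sub-hypergraph $\mathcal{H}$ of $K_n^r$ and $1\le s\le r$, $E_s(\mathcal{H})$ is the set of $s$-element subsets of vertices contained in some hyperedge of $\mathcal{H}$. A $d$-partition of $K_{rd}^r$ is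 pre-homogeneous if $|E_s(\mathcal{H}_i)|=\binom{rd}{s}$ for all $1\le i\le d$ and $1\le s\le r-1$. Betti numbers. Let $l_1,\dots,l_n$ be a basis of $\mathbb{R}^n$. To a sub-hypergraph $\mathcal{H}$ of $K_n^r$ associate the $(r-1)$-dimensional CW (simplicial) complex $X(\mathcal{H})\subseteq\mathbb{R}^n$ whose $(s-1)$-dimensional cells, $1\le s\le r$, are the simplices $\{t_1l_{a_1}+\dots+t_sl_{a_s}\mid t_j\in[0,1],\ \sum_j t_j=1\}$ for $\{a_1,\dots,a_s\}\in E_s(\mathcal{H})$. Then $b_q(\mathcal{H})$ denotes the $q$-th reduced Betti number of $X(\mathcal{H})$, $q\ge -1$ (the dimension of the degree $q$ homology of the augmented chain complex over a field of characteristic zero, with one generator in degree $-1$). *)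

(* Defs.v *)
From HB Require Import structures.
From mathcomp Require Import all_boot all_order all_fingroup all_algebra.

Set Implicit Arguments.
Unset Strict Implicit.
Unset Printing Implicit Defensive.

Import Order.TTheory GRing.Theory Num.Theory.

Local Open Scope ring_scope.

(* Vertices 1, ..., n are represented by 'I_n, so the vertex numbered s in the
   mathematical text is the ordinal of value s - 1. An increasing sequence
   i_1 < ... < i_r of vertices is represented by the set {i_1, ..., i_r};
   [enum] of that set lists it back in increasing order. *)

Definition redge (n r : nat) := {e : {set 'I_n} | #|e| == r}.

Section TensorPower.

Variables (k : fieldType) (I : finType) (d : nat).

(* The tensor power of V_d = k^d (row vectors, with basis [evec 0], [evec 1],
   and so on), with factors indexed by I, given by coordinates in the basis of
   the tensors (x)_i e_(f i), for f : I -> {1, ..., d}. *)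
Definition tensor_power := {ffun {ffun I -> 'I_d} -> k^o}.

Definition evec (q : 'I_d) : 'rV[k]_d := delta_mx 0 q.

Definition simple_tensor (v : I -> 'rV[k]_d) : tensor_power :=
  [ffun f : {ffun I -> 'I_d} => \prod_i v i 0 (f i)].

Lemma tensor_power_basis (t : tensor_power) :
  t = \sum_f t f *: simple_tensor (fun i => evec (f i)).
Proof.
apply/ffunP=> g; rewrite sum_ffunE (bigD1 g) //= !ffunE.
rewrite big1 ?mulr1 => [|i _]; last by rewrite mxE !eqxx.
rewrite (_ : t g *: _ = t g); last exact: mulr1.
rewrite big1 ?addr0 // => f neq_fg; rewrite !ffunE.
have [i neq_i]: exists i, f i != g i.
  apply/existsP; apply: contraR neq_fg; rewrite negb_exists => /forallP efg.
  by apply/eqP/ffunP=> i; apply/esym/eqP; rewrite -[_ == _]negbK eq_sym efg.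
rewrite (bigD1 i) //= mxE eqxx eq_sym (negPf neq_i) mul0r.
exact: scaler0.
Qed.

End TensorPower.

Definition lexle m (A B : {set 'I_m}) : bool :=
  (([seq val i | i <- enum A] : seqlexi nat) <= [seq val i | i <- enum B])%O.

Definition lexsets (m s : nat) : seq {set 'I_m} :=
  sort (@lexle m) (enum [set A : {set 'I_m} | #|A| == s]).

Lemma mem_lexsets m s (A : {set 'I_m}) : (A \in lexsets m s) = (#|A| == s).
Proof. by rewrite mem_sort mem_enum inE. Qed.

Lemma lexsets_uniq m s : uniq (lexsets m s).
Proof. by rewrite sort_uniq enum_uniq. Qed.

Lemma size_lexsets m s : size (lexsets m s) = 'C(m, s).
Proof. by rewrite size_sort -cardE card_draws card_ord. Qed.

Section DetSr.

Variables (k : fieldType) (r d : nat).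

Notation n := (r * d)%N.

(* The left-hand side of the equation E_(m_1, ..., m_(r-1)), for
   M = {m_1, ..., m_(r-1)}. Inserting s between m_j and m_(j+1) gives the edge
   s |: M, where j is the number of elements of M below s; the inner sum has
   exactly one term when #|M| = r - 1. The exponent (s - 1) + j of the text is
   s + j here, since the values of ordinals start at 0. *)
Definition equation_lhs (v : redge n r -> 'rV[k]_d) (lambda : redge n r -> k)
    (M : {set 'I_n}) : 'rV[k]_d :=
  \sum_(s | s \notin M) \sum_(e : redge n r | val e == s |: M)
     ((-1) ^+ (s + #|[set m in M | (m < s)%N]|) * lambda e) *: v e.

(* The (r-1)-sets indexing the equations with m_(r-1) < rd. *)
Definition row_sets : seq {set 'I_n} :=
  [seq M : {set 'I_n} <- lexsets n r.-1 | [forall m in M, (m.+1 < n)%N]].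

Lemma size_row_sets : (0 < r)%N -> (0 < d)%N ->
  size (row_sets) = 'C(n.-1, r.-1).
Proof.
move=> r_gt0 d_gt0; have n_gt0 : (0 < n)%N by rewrite muln_gt0 r_gt0.
rewrite /row_sets; move: (n) n_gt0 => [//|m] _ /=.
have ltP (i : 'I_m) : (i < m.+1)%N by rewrite ltnW // ltnS.
rewrite -[X in 'C(X, _)](card_ord m) -card_draws cardE.
pose w (i : 'I_m) : 'I_m.+1 := widen_ord (leqnSn m) i.
have w_inj : injective w by move=> i j /(congr1 val)/= /val_inj.
rewrite -[RHS](size_map (fun A : {set 'I_m} => w @: A)).
apply: perm_size; apply: uniq_perm.
- by rewrite filter_uniq // lexsets_uniq.
- by rewrite map_inj_uniq ?enum_uniq //; apply: imset_inj.
move=> M; rewrite mem_filter mem_lexsets; apply/andP/mapP.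
  case=> /forall_inP-ltM /eqP cM.
  exists (w @^-1: M); last first.
    apply/setP=> x; apply/idP/imsetP => [xM|[y] /[1!inE] yM -> //].
    have ltx : (x < m)%N by have := ltM x xM.
    by exists (Ordinal ltx); rewrite ?inE; [rewrite (_ : w _ = x) //|]; apply: val_inj.
  rewrite mem_enum inE -cM -(card_imset _ w_inj); apply/eqP.
  congr #|pred_of_set _|; apply/setP=> x; apply/imsetP/idP=> [[y] /[1!inE] yM -> //|xM].
  have ltx : (x < m)%N by have := ltM x xM.
  by exists (Ordinal ltx); rewrite ?inE; [rewrite (_ : w _ = x) //|]; apply: val_inj.
case=> A; rewrite mem_enum inE => /eqP cA ->; rewrite card_imset // cA eqxx.
by split=> //; apply/forall_inP=> _ /imsetP[i _ ->] /=; rewrite ltnS.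
Qed.

Lemma bin_block : (0 < r)%N -> (0 < d)%N -> (d * 'C(n.-1, r.-1) = 'C(n, r))%N.
Proof.
move=> r_gt0 d_gt0; apply/eqP; rewrite -(eqn_pmul2l r_gt0) mulnA.
by have := mul_bin_diag n r.-1; rewrite prednK // => ->.
Qed.

Lemma coord_subproof N (a : 'I_(d * N)) : (a %% d < d)%N.
Proof. by case: d a => [|d'] [a lt_a]; rewrite ?ltn_pmod. Qed.

(* Row a is the coordinate a %% d of the equation number a %/ d; the entry in
   column b is its coefficient at the b-th unknown. *)
Definition Amx (v : redge n r -> 'rV[k]_d) : 'M[k]_(d * 'C(n.-1, r.-1)) :=
  \matrix_(a, b)
    equation_lhs v (fun e => (val e == nth set0 (lexsets n r) b)%:R)
      (nth set0 row_sets (a %/ d)) 0 (Ordinal (coord_subproof a)).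

(* Linear by construction, and characterized by [detS_simple_tensor] below, since
   the simple tensors span. *)
Definition detS (t : tensor_power k (redge n r) d) : k^o :=
  \sum_f t f * \det (Amx (fun e => evec k (f e))).

Lemma detS_is_linear : linear detS.
Proof.
move=> c t u; rewrite /detS scaler_sumr -big_split /=.
by apply: eq_bigr => f _; rewrite !ffunE mulrDl -[c *: t f]/(c * t f) -mulrA.
Qed.

HB.instance Definition _ :=
  GRing.isLinear.Build k (tensor_power k (redge n r) d) k^o *:%R detS
    detS_is_linear.

Lemma detS_simple_tensor (v : redge n r -> 'rV[k]_d) :
  (0 < r)%N -> (0 < d)%N -> detS (simple_tensor v) = \det (Amx v).
Proof.
move=> r_gt0 d_gt0; pose N := (d * 'C(n.-1, r.-1))%N.
have ltN (b : 'I_N) : (b < size (lexsets n r))%N.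
  by rewrite size_lexsets -bin_block.
have colP (b : 'I_N) : #|nth set0 (lexsets n r) b| == r.
  by rewrite -mem_lexsets mem_nth.
pose col (b : 'I_N) : redge n r :=
  exist (fun e : {set 'I_n} => is_true (#|e| == r)) _ (colP b).
have col_inj : injective col.
  move=> b c /(congr1 val)/= /eqP; rewrite nth_uniq ?lexsets_uniq ?ltN //.
  by move/eqP/val_inj.
have cardN : (#|{: redge n r}| <= #|'I_N|)%N.
  by rewrite card_sig -cardsE card_draws !card_ord -bin_block.
have col_bij : bijective col by exact: inj_card_bij col_inj cardN.
pose row a := nth set0 (row_sets) (a %/ d).
pose cd (a : 'I_N) := Ordinal (coord_subproof a).
pose K (a b : 'I_N) : k :=
  \sum_(s | (s \notin row a) && (val (col b) == s |: row a))
     (-1) ^+ (s + #|[set m in row a | (m < s)%N]|).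
have AE (u : redge n r -> 'rV[k]_d) a b : Amx u a b = K a b * u (col b) 0 (cd a).
  rewrite mxE /equation_lhs summxE mulr_suml big_mkcondr /=.
  apply: eq_bigr => s _; rewrite summxE.
  rewrite (big_mkcond (fun e : redge n r => val e == _)) (bigD1 (col b)) //=.
  rewrite big1 ?addr0 => [|e neq_eb]; last first.
    case: eqP => // _; rewrite mxE -[_ == nth _ _ _]/(val e == val (col b)).
    by rewrite val_eqE (negPf neq_eb) mulr0 mul0r.
  by case: ifP => // _; rewrite mxE eqxx mulr1.
have [row_of colK colK'] := col_bij.
rewrite /detS /determinant.
under eq_bigr => f _ do rewrite mulr_sumr.
rewrite exchange_big; apply: eq_bigr => s _ /=.
under eq_bigr => f _ do rewrite mulrCA; rewrite -mulr_sumr; congr (_ * _).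
pose g (e : redge n r) : 'I_N := ((s : {perm 'I_N})^-1)%g (row_of e).
have gK a : g (col (s a)) = a by rewrite /g colK permK.
have gK' e : col (s (g e)) = e by rewrite /g permKV colK'.
pose fs : {ffun redge n r -> 'I_d} := [ffun e => cd (g e)].
rewrite (bigD1 fs) //= [X in _ + X]big1 ?addr0 => [|f neq_f]; last first.
  have [e neq_e] : exists e, f e != fs e.
    apply/existsP; apply: contraR neq_f; rewrite negb_exists => /forallP eqf.
    by apply/eqP/ffunP=> e; apply/eqP/negbNE/eqf.
  rewrite (bigD1 (g e)) //= AE gK' mxE eqxx eq_sym /=.
  by move: neq_e; rewrite ffunE => /negPf->; rewrite mulr0 mul0r mulr0.
rewrite ffunE [X in X * _](reindex (fun a => col (s a))) /=; last first.
  by exists g => [a _|e _].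
rewrite -big_split; apply: eq_bigr => a _ /=.
by rewrite !AE !ffunE gK mxE !eqxx mulr1 mulrC.
Qed.

End DetSr.

Section Hypergraphs.

Variables (n r d : nat).

Definition hypergraph := {set redge n r}.

Definition is_partition (H : 'I_d -> hypergraph) : Prop :=
  (forall i j : 'I_d, i != j -> [disjoint H i & H j])
  /\ \bigcup_i H i = [set: redge n r].

Definition Eset (H : hypergraph) (s : nat) : {set {set 'I_n}} :=
  [set X : {set 'I_n} | #|X| == s & [exists e in H, X \subset val e]].

Definition pre_homogeneous (H : 'I_d -> hypergraph) : Prop :=
  forall (i : 'I_d) (s : nat), (1 <= s <= r.-1)%N -> #|Eset (H i) s| = 'C(n, s).

(* The simple tensor whose factor at e is e_q, where e is an edge of H_q. *)
Definition omega (k : fieldType) (H : 'I_d -> hypergraph) :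
    tensor_power k (redge n r) d :=
  simple_tensor
    (fun e => if [pick q | e \in H q] is Some q then evec k q else 0).

(* The q-dimensional cells of X(H), together with the empty simplex in
   degree -1. *)
Definition cells (H : hypergraph) (q : int) : {set {set 'I_n}} :=
  match q with
  | Posz p => Eset H p.+1
  | Negz 0 => [set set0]
  | Negz _ => set0
  end.

Definition incidence (F : fieldType) (X Y : {set 'I_n}) : F :=
  \sum_(x in X | X :\ x == Y) (-1) ^+ #|[set y in X | (y < x)%N]|.

(* The boundary map from degree p to degree q = p - 1 in the augmented chain
   complex of X(H) over F, acting on row vectors. *)
Definition boundary (F : fieldType) (H : hypergraph) (p q : int) :
    'M[F]_(#|cells H p|, #|cells H q|) :=
  \matrix_(a, b) incidence F (enum_val a) (enum_val b).

(* dim Ker - dim Im, a true difference by [boundary_boundary] below. *)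
Definition betti (F : fieldType) (H : hypergraph) (q : int) : nat :=
  (\rank (kermx (boundary F H q (q - 1)))
   - \rank (boundary F H (q + 1) q))%N.

End Hypergraphs.

Section BoundaryBoundary.

Variables (n r : nat) (F : fieldType) (H : hypergraph n r).

Lemma cells_face (q : int) (X : {set 'I_n}) (x : 'I_n) :
  x \in X -> X \in cells H (q + 1) -> X :\ x \in cells H q.
Proof.
move=> xX; case: q => [p|[|[|p]]]; rewrite ?addn1 /= ?inE ?subn0 //=.
- rewrite addn1 (cardsD1 x) xX eqSS => /andP[-> /existsP[e /andP[eH sX]]] /=.
  by apply/existsP; exists e; rewrite eH (subset_trans _ sX) ?subD1set.
- by rewrite (cardsD1 x) xX eqSS cards_eq0 => /andP[].
- by move/eqP=> X0; rewrite X0 inE in xX.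
Qed.

Lemma boundary_boundary (q : int) :
  boundary F H (q + 1) q *m boundary F H q (q - 1) = 0.
Proof.
apply/matrixP=> a c; rewrite !mxE.
under eq_bigr => b _ do rewrite !mxE.
have := enum_valP a; move: (enum_val a) (enum_val c) => X Z XH.
rewrite -(big_enum_val (fun Y : {set 'I_n} => incidence F X Y * incidence F Y Z)) /=.
pose sg (U : {set 'I_n}) (x : 'I_n) : F := (-1) ^+ #|[set y in U | (y < x)%N]|.
pose f x y := if [&& x \in X, y \in X, x != y & X :\ x :\ y == Z]
  then sg X x * sg (X :\ x) y else 0.
transitivity (\sum_x \sum_y f x y).
  under eq_bigr => Y _ do rewrite /incidence mulr_suml.
  rewrite (exchange_big_dep (fun x => x \in X)) /=; last by move=> ? ? _ /andP[].
  rewrite [LHS]big_mkcond; apply: eq_bigr => x _; case: ifP => xX; last first.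
    by rewrite big1 // => y _; rewrite /f xX.
  rewrite (big_pred1 (X :\ x)) => [|Y]; last first.
    rewrite /= xX /= eq_sym andb_idl // => /eqP->.
    exact: cells_face.
  rewrite mulr_sumr big_mkcond; apply: eq_bigr => y _; rewrite /f !inE xX /=.
  by rewrite eq_sym (andbC (x != y)) -andbA.
have fN (x y : 'I_n) : (x < y)%N -> f y x = - f x y.
  move=> lt_xy; rewrite /f (eq_sym y x).
  have -> : X :\ y :\ x = X :\ x :\ y by rewrite !setDDl setUC.
  rewrite [(y \in X) && _]andbCA; case: ifP; last by rewrite oppr0.
  case/and4P=> xX yX neq_xy _; rewrite /sg mulrC.
  have -> : [set y0 in X :\ y | (y0 < x)%N] = [set y0 in X | (y0 < x)%N].
    apply/setP=> z; rewrite !inE; case: eqP => // ->.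
    by rewrite [(y < x)%N]ltnNge (ltnW lt_xy) !andbF.
  rewrite -mulrN -[X in _ = _ * X]mulN1r -exprS; congr (_ * _ ^+ _).
  rewrite (cardsD1 x) !inE xX lt_xy add1n; congr (#|pred_of_set _|.+1).
  by apply/setP=> z; rewrite !inE andbA.
have f0 (x : 'I_n) : f x x = 0 by rewrite /f eqxx !andbF.
transitivity (\sum_(x : 'I_n) \sum_(y : 'I_n | (x < y)%N) f x y
     + \sum_(x : 'I_n) \sum_(y : 'I_n | (y < x)%N) f x y).
  rewrite -big_split; apply: eq_bigr => x _ /=.
  rewrite (bigID (fun y : 'I_n => (x < y)%N)) /=; congr (_ + _).
  rewrite big_mkcond [RHS]big_mkcond; apply: eq_bigr => y _.
  by rewrite -leqNgt leq_eqVlt val_eqE; case: eqP => [->|]; rewrite ?f0 ?ltnn.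
rewrite [X in _ + X](exchange_big_dep predT) //= -big_split big1 // => x _ /=.
by rewrite (eq_bigr _ (fN x)) sumrN subrr.
Qed.

End BoundaryBoundary.

(* Main.v *)
Require Import Defs.
From mathcomp Require Import all_boot all_order all_fingroup all_algebra.

Set Implicit Arguments.
Unset Strict Implicit.
Unset Printing Implicit Defensive.

Import Order.TTheory GRing.Theory Num.Theory.

Local Open Scope ring_scope.

(* Up to signs of rows and columns, the equations E_M split according to the
   color of the edges into d blocks, the block of color i being the top boundary
   map of X(H_i), with only the (r-1)-sets M avoiding the last vertex as rows. The
   boundary of a chain is a cycle, and a cycle vanishing off the star of a vertex
   is zero, so omitting the other rows does not change the kernel: the determinant
   is nonzero iff all d top boundary maps are injective, i.e. b_(r-1)(H_i) = 0.
   In that case each H_i has at most, hence by counting exactly, 'C(rd-1, r-1)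
   edges. Every block is then square and invertible, for any choice of the omitted
   vertex, so no (r-1)-set is left uncovered; the lower Betti numbers vanish since
   the boundary map has rank at least the number of cells containing a vertex.
   The coefficients are integers, so the determinant may be computed over k or F. *)

(** * Chains on vertex sets and injectivity of boundary maps *)

Section Chains.

Variables (n : nat) (F : fieldType).
Implicit Types (c : {set 'I_n} -> F) (v s t : 'I_n) (M X Y : {set 'I_n}).
Implicit Types P Q : {set {set 'I_n}}.

Definition below M s : nat := #|[set m in M | (m < s)%N]|.

(** A chain is a function on sets of all sizes, so [bd] can be iterated without changing type; a
    complex enters only through vanishing conditions. *)
Definition bd c M : F := \sum_(s | s \notin M) (-1) ^+ below M s * c (s |: M).

Lemma below_setU1 M s t :
  s \notin M -> below (s |: M) t = ((s < t) + below M t)%N.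
Proof.
move=> sM; rewrite /below (cardsD1 s) !inE eqxx /=; congr (_ + _)%N.
apply: eq_card => x; rewrite !inE; case: eqP => //= ->.
by rewrite (negPf sM).
Qed.

Lemma sum_antisym (f : 'I_n -> 'I_n -> F) :
  (forall s, f s s = 0) -> (forall s t, (s < t)%N -> f t s = - f s t) ->
  \sum_s \sum_t f s t = 0.
Proof.
move=> f0 fN.
transitivity (\sum_(s : 'I_n) \sum_(t : 'I_n | (s < t)%N) f s t
     + \sum_(s : 'I_n) \sum_(t : 'I_n | (t < s)%N) f s t).
  rewrite -big_split; apply: eq_bigr => s _ /=.
  rewrite (bigID (fun t : 'I_n => (s < t)%N)) /=; congr (_ + _).
  rewrite big_mkcond [RHS]big_mkcond; apply: eq_bigr => t _.
  by rewrite -leqNgt leq_eqVlt val_eqE; case: eqP => [->|]; rewrite ?f0 ?ltnn.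
rewrite [X in _ + X](exchange_big_dep predT) //= -big_split big1 // => s _ /=.
by rewrite (eq_bigr _ (fN s)) sumrN subrr.
Qed.

(** Adding [s] and [t] in either order gives the same set with opposite signs. *)
Lemma bd_bd c M : bd (bd c) M = 0.
Proof.
pose f s t := if [&& s \notin M, t \notin M & s != t]
  then (-1) ^+ below M s * ((-1) ^+ ((s < t) + below M t)%N * c (t |: (s |: M)))
  else 0.
rewrite -[RHS](@sum_antisym f) => [|s|s t lt_st].
- rewrite /bd big_mkcond; apply: eq_bigr => s _; rewrite /f.
  case: ifP => sM /=; last by rewrite big1.
  rewrite mulr_sumr [LHS]big_mkcond; apply: eq_bigr => t _.
  rewrite !inE negb_or andbC eq_sym; case: ifP => // _.
  by rewrite below_setU1.
- by rewrite /f eqxx !andbF.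
rewrite /f eq_sym andbCA; case: ifP => _; last by rewrite oppr0.
rewrite lt_st ltnNge (ltnW lt_st) /= add0n add1n setUCA exprS mulN1r.
by rewrite !mulNr mulrN opprK mulrCA.
Qed.

Lemma bd_star c v M : v \notin M -> (forall X, v \notin X -> c X = 0) ->
  bd c M = (-1) ^+ below M v * c (v |: M).
Proof.
move=> vM c0; rewrite /bd (bigD1 v) //= big1 ?addr0 // => s /andP[_ neq_sv].
by rewrite c0 ?mulr0 // !inE negb_or eq_sym neq_sv.
Qed.

(** Each [c X] with [v] in [X] is, up to sign, the boundary coefficient at [X :\ v]. Only those [M]
    with [c (v |: M)] nonzero have to be tested. *)
Lemma bd_star_inj c v : (forall X, v \notin X -> c X = 0) ->
  (forall M, v \notin M -> v |: M \in support c -> bd c M = 0) -> c =1 fun=> 0.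
Proof.
move=> c0 bd0 X; have [vX|/c0//] := boolP (v \in X).
apply/eqP; apply: contraT => cX.
have vM : v \notin X :\ v by rewrite !inE eqxx.
have := bd0 _ vM; rewrite (bd_star vM c0) setD1K // => /(_ cX)/eqP.
by rewrite mulf_eq0 signr_eq0 (negPf cX).
Qed.

(** [bd_star_inj] applies to the chain [bd c], whose own boundary is zero. *)
Lemma bd_eq0_off_star c v :
  (forall M, v \notin M -> bd c M = 0) -> bd c =1 fun=> 0.
Proof. by move=> /bd_star_inj; apply=> M _ _; apply: bd_bd. Qed.

Lemma sum_incidence c M : \sum_X c X * incidence F X M = bd c M.
Proof.
under eq_bigr do rewrite mulr_sumr.
rewrite (exchange_big_dep xpredT) //= /bd [RHS]big_mkcond; apply: eq_bigr => s _.
case: ifP => sM; last first.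
  rewrite big1 // => X /andP[sX /eqP defM].
  by rewrite -defM !inE eqxx in sM.
rewrite (big_pred1 (s |: M)) => [|X]; last first.
  apply/andP/eqP => [[sX /eqP <-]|->]; first by rewrite setD1K.
  by rewrite !inE eqxx setU1K.
by rewrite mulrC -/(below _ _) below_setU1 // ltnn.
Qed.

(** Up to conversion, [boundary F H p q] is the case of [cells H p] and [cells H q]; arbitrary
    families also allow dropping rows and columns. *)
Definition incmx P Q : 'M[F]_(#|P|, #|Q|) :=
  \matrix_(a, b) incidence F (enum_val a) (enum_val b).

Definition bd_inj P Q := forall c, (forall X, X \notin P -> c X = 0) ->
  (forall M, M \in Q -> bd c M = 0) -> c =1 fun=> 0.

Lemma mul_incmx P Q c b : (forall X, X \notin P -> c X = 0) ->
  ((\row_a c (enum_val a)) *m incmx P Q) 0 b = bd c (enum_val b).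
Proof.
move=> cP; rewrite -sum_incidence mxE (bigID [in P]) /= [X in _ + X]big1.
  rewrite addr0 (big_enum_val (fun X => c X * incidence F X (enum_val b))).
  by apply: eq_bigr => a _; rewrite !mxE.
by move=> X /cP->; rewrite mul0r.
Qed.

(** This trades matrices, whose types depend on [P] and [Q], for conditions on functions, where [P]
    and [Q] can be changed freely. *)
Lemma row_free_incmx P Q : row_free (incmx P Q) <-> bd_inj P Q.
Proof.
split=> [free c cP c0 X | inj].
  have /eqP : (\row_a c (enum_val a)) *m incmx P Q = 0.
    by apply/rowP=> b; rewrite mul_incmx // mxE c0 // enum_valP.
  rewrite mulmx_free_eq0 // => /eqP/rowP row0.
  have [XP|/cP//] := boolP (X \in P).
  by have := row0 (enum_rank_in XP X); rewrite !mxE enum_rankK_in.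
apply: inj_row_free => u u0.
pose c X := \sum_(a | enum_val a == X) u 0 a.
have cE a : c (enum_val a) = u 0 a.
  by rewrite /c (big_pred1 a) // => b; apply: (inj_eq enum_val_inj).
have cP X : X \notin P -> c X = 0.
  move=> XP; rewrite /c big_pred0 // => a.
  by apply: contraNF XP => /eqP<-; apply: enum_valP.
have uE : u = \row_a c (enum_val a) by apply/rowP=> a; rewrite mxE cE.
have c0 : c =1 fun=> 0.
  apply: (inj c cP) => M MQ.
  by rewrite -(enum_rankK_in MQ MQ) -(@mul_incmx P) // -uE u0 mxE.
by apply/rowP=> a; rewrite -cE c0 mxE.
Qed.

Lemma rank_incmx_sub P P' Q : P' \subset P ->
  (\rank (incmx P' Q) <= \rank (incmx P Q))%N.
Proof.
move=> sP; apply/mxrankS/row_subP=> a.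
have aP := subsetP sP _ (enum_valP a).
have -> : row a (incmx P' Q) = row (enum_rank_in aP (enum_val a)) (incmx P Q).
  by apply/rowP=> b; rewrite !mxE enum_rankK_in.
exact: row_sub.
Qed.

(** A chain on the sets of [P] containing [v] is recovered from its boundary at the faces opposite
    [v], which lie in [Q]; these rows are therefore independent. *)
Lemma rank_incmx_star P Q v :
  (forall X, X \in P -> v \in X -> X :\ v \in Q) ->
  (#|[set X in P | v \in X]| <= \rank (incmx P Q))%N.
Proof.
move=> faceQ; set Pv := [set _ in P | _].
have /eqP<- : row_free (incmx Pv Q).
  apply/row_free_incmx => c cP c0; apply: (@bd_star_inj _ v) => [X vX|M vM].
    by apply: cP; rewrite inE (negPf vX) andbF.
  rewrite inE => cM; apply: c0.
  have : v |: M \in Pv by apply: contraNT cM => /cP->.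
  by rewrite inE => /andP[MP vvM]; rewrite -(setU1K vM) faceQ.
by apply: rank_incmx_sub; apply/subsetP=> X; rewrite inE => /andP[].
Qed.

Lemma bd_inj_sub P Q Q' : Q \subset Q' -> bd_inj P Q -> bd_inj P Q'.
Proof.
by move=> /subsetP sQ inj c cP c0; apply: (inj c cP) => M /sQ; apply: c0.
Qed.

(** A set outside [Q] is a facet of no member of [P], so the boundary vanishes at every set without
    [v], hence everywhere by [bd_eq0_off_star]. *)
Lemma bd_inj_off_star P Q v :
  (forall X s, X \in P -> s \in X -> X :\ s \in Q) ->
  bd_inj P Q -> bd_inj P [set M in Q | v \notin M].
Proof.
move=> faceQ inj c cP c0; apply: (inj c cP) => M _.
apply: (@bd_eq0_off_star _ v) => {}M vM.
have [MQ|MQ] := boolP (M \in Q); first by rewrite c0 // inE MQ.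
rewrite /bd big1 // => s sM; rewrite cP ?mulr0 //.
by apply: contra MQ => /faceQ/(_ (setU11 _ _)); rewrite setU1K.
Qed.

Lemma card_bd_inj P Q : bd_inj P Q -> (#|P| <= #|Q|)%N.
Proof. by move=> /row_free_incmx/eqP <-; apply: rank_leq_col. Qed.

(* A square injective matrix is surjective, so it has no zero column. *)
Lemma bd_inj_cover P Q M : bd_inj P Q -> #|P| = #|Q| -> M \in Q ->
  exists2 X, X \in P & M \subset X.
Proof.
move=> /row_free_incmx/eqP rkP eqPQ MQ.
have /row_fullP[B BA1] : row_full (incmx P Q) by rewrite /row_full rkP eqPQ.
have [/existsP[a sMa]|noX] := boolP [exists a : 'I_#|P|, M \subset enum_val a].
  by exists (enum_val a); rewrite ?enum_valP.
move/matrixP/(_ (enum_rank_in MQ M) (enum_rank_in MQ M))/eqP: BA1.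
rewrite !mxE big1 ?eqxx ?(eq_sym 0) ?oner_eq0 // => a _.
rewrite mxE enum_rankK_in // /incidence big_pred0 ?mulr0 // => x.
apply: contraNF noX => /andP[_ /eqP<-]; apply/existsP; exists a.
exact: subD1set.
Qed.

End Chains.

(** * Betti numbers and skeleta of X(H) *)

Lemma ex_superset n (A : {set 'I_n}) m : (#|A| <= m <= n)%N ->
  exists2 M : {set 'I_n}, #|M| = m & A \subset M.
Proof.
case/andP; elim: m => [|m IHm] leAm le_mn.
  by exists A => //; apply/eqP; rewrite -leqn0.
move: leAm; rewrite leq_eqVlt => /predU1P[cA|]; first by exists A.
case/IHm => [|M cM sAM]; first exact: ltnW.
have /set0Pn[x] : ~: M != set0.
  by rewrite -card_gt0 -(ltn_add2l #|M|) cardsC cM card_ord addn0.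
rewrite inE => xM; exists (x |: M); first by rewrite cardsU1 xM cM.
by rewrite (subset_trans sAM) ?subsetUr.
Qed.

Section Complex.

Variables (n r : nat) (F : fieldType).
Implicit Types (H : hypergraph n r) (v : 'I_n) (X M : {set 'I_n}) (q : int).

Definition draws s : {set {set 'I_n}} := [set X : {set 'I_n} | #|X| == s].

Definition supports H : {set {set 'I_n}} := [set val e | e in H].

Lemma card_draws_off s v : #|[set M in draws s | v \notin M]| = 'C(n.-1, s).
Proof.
have -> : n.-1 = #|~: [set v]| by rewrite cardsC1 card_ord.
rewrite -cards_draws; apply: eq_card => M; rewrite !inE andbC; congr (_ && _).
by rewrite subsetC sub1set inE.
Qed.

Lemma Eset_top H : Eset H r = supports H.
Proof.
apply/setP=> X; rewrite inE; apply/andP/imsetP => [[cX /exists_inP[e eH sXe]]|].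
  exists e => //; apply/eqP; rewrite eqEcard sXe (eqP cX).
  by rewrite (eqP (valP e)) leqnn.
case=> e eH ->; split; first exact: (valP e).
by apply/exists_inP; exists e.
Qed.

Lemma card_supports H : #|supports H| = #|H|.
Proof. by rewrite card_imset //; apply: val_inj. Qed.

Lemma supports_face H X v : X \in supports H -> v \in X -> X :\ v \in draws r.-1.
Proof.
case/imsetP=> e _ -> ve; rewrite inE.
by have /eqP := valP e; rewrite (cardsD1 v) ve add1n => /(congr1 predn)/= ->.
Qed.

Lemma cells_card H q X : X \in cells H q -> q = #|X|%:Z - 1.
Proof.
case: q => [p|[|p]] /=; rewrite !inE //.
  by case/andP=> /eqP-> _; rewrite -addn1 PoszD addrK.
by move/eqP->; rewrite cards0.
Qed.

(** The faces range over all (r-1)-sets, as in the equations, and not only over [Eset H r.-1]. *)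
Definition top_injective H := bd_inj F (supports H) (draws r.-1).

(** An (r-1)-set outside [Eset H r.-1] lies in no edge, so the boundary vanishes there anyway. As
    [r] is at least 2, both degrees are nonnegative and their cells are given by [Eset]. *)
Lemma top_boundary_free H : (2 <= r)%N ->
  row_free (boundary F H (r%:Z - 1) (r%:Z - 1 - 1)) <-> top_injective H.
Proof.
move=> r_ge2.
have r1_gt0 : (0 < r.-1)%N by rewrite -ltnS (ltn_predK r_ge2).
rewrite -predn_int ?(ltnW r_ge2) // -predn_int //.
apply: iff_trans (row_free_incmx F (Eset H r.-1.+1) (Eset H r.-2.+1)) _.
rewrite !prednK ?(ltnW r_ge2) // Eset_top.
split; first by apply: bd_inj_sub; apply/subsetP=> X; rewrite !inE => /andP[].
move=> inj c cP c0; apply: (inj c cP) => M; rewrite inE => cM.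
have [MQ|MQ] := boolP (M \in Eset H r.-1); first exact: c0.
rewrite /bd big1 // => s sM; rewrite cP ?mulr0 //.
apply: contra MQ => /imsetP[e eH def_e]; rewrite inE cM.
by apply/exists_inP; exists e; rewrite // -def_e subsetUr.
Qed.

Lemma boundary_ker0 H q : row_free (boundary F H q (q - 1)) -> betti F H q = 0%N.
Proof. by rewrite -kermx_eq0 /betti => /eqP->; rewrite mxrank0. Qed.

Lemma betti_top H : (2 <= r)%N ->
  betti F H (r%:Z - 1) = 0%N <-> top_injective H.
Proof.
move=> r_ge2; split=> [b0|/(top_boundary_free H r_ge2)/boundary_ker0//].
apply/top_boundary_free => //; move: b0.
(* A cell of degree r would have r + 1 vertices, more than any edge; the Betti number is thus the
   dimension of the kernel. *)
have top0 : cells H (r%:Z - 1 + 1) = set0.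
  rewrite subrK /=; apply/setP=> X; rewrite !inE.
  apply/negP=> /andP[/eqP cX /exists_inP[e _ /subset_leq_card]].
  by rewrite cX (eqP (valP e)) ltnn.
rewrite /betti -kermx_eq0 -mxrank_eq0 => /eqP; rewrite subn_eq0.
move=> /leq_trans le; rewrite -leqn0; apply: le.
by apply: leq_trans (rank_leq_row _) _; rewrite top0 cards0.
Qed.

(** By [rank_incmx_star] the outgoing boundary has rank at least the number of cells containing [v],
    so its kernel has dimension at most the number of the others. *)
Lemma betti_eq0 H q v :
  (#|[set X in cells H q | v \notin X]| <= \rank (boundary F H (q + 1) q))%N ->
  betti F H q = 0%N.
Proof.
move=> le_rk; apply/eqP; rewrite subn_eq0; apply: leq_trans le_rk.
rewrite mxrank_ker leq_subLR.
have cq : #|cells H q|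
    = (#|[set X in cells H q | v \in X]| + #|[set X in cells H q | v \notin X]|)%N.
  rewrite -[LHS](cardsID [set X : {set 'I_n} | v \in X]).
  by congr (_ + _)%N; apply: eq_card => X; rewrite !inE // andbC.
rewrite [leqLHS]cq leq_add2r; apply: rank_incmx_star => X XH vX.
by apply: cells_face vX _; rewrite subrK.
Qed.

Lemma top_injective_off H v :
  top_injective H -> bd_inj F (supports H) [set M in draws r.-1 | v \notin M].
Proof. exact: bd_inj_off_star (@supports_face H). Qed.

Lemma top_injective_card H v : top_injective H -> (#|H| <= 'C(n.-1, r.-1))%N.
Proof.
move=> /(@top_injective_off _ v)/card_bd_inj.
by rewrite card_supports card_draws_off.
Qed.

Definition full_skeleton H := forall s, (s < r)%N -> Eset H s = draws s.

Hypothesis lt_rn : (r.-1 < n)%N.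

(** Enlarge a small set to an (r-1)-set [M] and omit a vertex [v] outside [M]: the block is then
    square, and [bd_inj_cover] puts [M] inside an edge. *)
Lemma top_injective_full H : top_injective H -> #|H| = 'C(n.-1, r.-1) ->
  full_skeleton H.
Proof.
move=> inj cH s lt_sr; apply/setP=> A; rewrite !inE andb_idr // => /eqP cA.
have [|M cM sAM] := @ex_superset _ A r.-1.
  by rewrite cA (ltnW lt_rn) andbT -ltnS (ltn_predK lt_sr).
have /set0Pn[v] : ~: M != set0.
  by rewrite -card_gt0 -(ltn_add2l #|M|) cardsC cM card_ord addn0.
rewrite inE => vM; have /bd_inj_cover := @top_injective_off _ v inj.
rewrite card_supports card_draws_off => /(_ M cH)[]; first by rewrite !inE cM eqxx.
move=> _ /imsetP[e eH ->] sMe.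
by apply/exists_inP; exists e; rewrite ?(subset_trans sAM).
Qed.

Lemma mem_cells_full H X : full_skeleton H -> (#|X| < r)%N ->
  X \in cells H (#|X|%:Z - 1).
Proof.
move=> full; have [->|/set0Pn[x xX]] := eqVneq X set0.
  by rewrite cards0 /= inE.
have X_gt0 : (0 < #|X|)%N by apply/card_gt0P; exists x.
by move/full=> E; rewrite -predn_int //= (ltn_predK X_gt0) E inE.
Qed.

Lemma betti_full H q : (2 <= r)%N -> top_injective H -> #|H| = 'C(n.-1, r.-1) ->
  q <= r%:Z - 1 -> betti F H q = 0%N.
Proof.
move=> r_ge2 inj cH; have full := top_injective_full inj cH.
rewrite le_eqVlt => /predU1P[->|lt_qr]; first exact/betti_top.
have v : 'I_n := Ordinal (leq_ltn_trans (leq0n _) lt_rn).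
apply: (@betti_eq0 _ _ v).
(* In degree r - 2, adding [v] to a cell need not give an edge. Instead, the rank of the injective
   top boundary is the number of edges, which is the number of (r-1)-sets without [v]. *)
have [eq_q|neq_q] := eqVneq q (r%:Z - 1 - 1).
  rewrite eq_q subrK; have /eqP-> := (top_boundary_free H r_ge2).2 inj.
  have -> : #|cells H (r%:Z - 1)| = 'C(n.-1, r.-1).
    rewrite -cH -card_supports -Eset_top; congr #|pred_of_set _|.
    by rewrite -predn_int ?(ltnW r_ge2) //= (ltn_predK r_ge2).
  rewrite -(card_draws_off _ v); apply/subset_leq_card/subsetP=> X.
  rewrite !inE => /andP[/cells_card/eqP + ->]; rewrite andbT.
  rewrite (can_eq (subrK 1)) subr_eq.
  by rewrite -(subrK 1 r%:Z) -predn_int ?(ltnW r_ge2) // (inj_eq (addIr 1)) eq_sym.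
(* In lower degrees, each cell [X] without [v] yields [v |: X], a cell because it has fewer than r
   vertices. *)
apply: leq_trans (rank_incmx_star (v := v) _ _) => [|X XH vX]; last first.
  exact: cells_face.
rewrite -(@card_in_imset _ _ (fun X => v |: X)); last first.
  move=> X Y /[!inE] /andP[_ vX] /andP[_ vY] /(congr1 (fun Z => Z :\ v)).
  by rewrite !setU1K.
apply/subset_leq_card/subsetP=> _ /imsetP[X + ->].
rewrite !inE eqxx orTb andbT => /andP[/cells_card def_q vX].
have cvX : #|v |: X| = #|X|.+1 by rewrite cardsU1 vX.
have -> : q + 1 = #|v |: X|%:Z - 1 by rewrite cvX -addn1 PoszD addrK def_q subrK.
apply: mem_cells_full => //; rewrite cvX.
move: lt_qr neq_q; rewrite def_q ltrD2r (can_eq (subrK 1)) ltz_nat.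
rewrite leq_eqVlt => /predU1P[<-|//].
by rewrite -addn1 PoszD addrK eqxx.
Qed.

End Complex.

(** * The matrix [Amx] as a linear system, split by color *)

Section Determinant.

Variables (F : fieldType) (r d : nat).
Hypotheses (r_gt0 : (0 < r)%N) (d_gt0 : (0 < d)%N).

Notation n := (r * d)%N.
Notation N := (d * 'C(n.-1, r.-1))%N.
Implicit Types (v : redge n r -> 'rV[F]_d) (lam : redge n r -> F).
Implicit Types (M X : {set 'I_n}).

Lemma equation_lhs_sum v (I : finType) (g : redge n r -> I -> F) (x : I -> F) M :
  equation_lhs v (fun e => \sum_b g e b * x b) M
    = \sum_b x b *: equation_lhs v (g^~ b) M.
Proof.
under [RHS]eq_bigr do rewrite scaler_sumr.
rewrite exchange_big; apply: eq_bigr => s _ /=.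
under [RHS]eq_bigr do rewrite scaler_sumr.
rewrite exchange_big; apply: eq_bigr => e _ /=.
rewrite mulr_sumr scaler_suml; apply: eq_bigr => b _.
by rewrite scalerA mulrA mulrC.
Qed.

(** The columns of the square matrix [Amx v] enumerate all edges and its rows the coordinates of the
    equations, so its kernel is the solution space. *)
Lemma det_Amx_neq0 v : \det (Amx v) != 0 <->
  (forall lam, (forall M, M \in row_sets r d -> equation_lhs v lam M = 0) ->
     lam =1 fun=> 0).
Proof.
have szL : size (lexsets n r) = N by rewrite size_lexsets bin_block.
have szR : size (row_sets r d) = 'C(n.-1, r.-1) by rewrite size_row_sets.
(* The 0-1 matrix [g] identifies column vectors with families indexed by edges. *)
pose g (e : redge n r) (b : 'I_N) : F := (val e == nth set0 (lexsets n r) b)%:R.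
have idx (e : redge n r) : {b : 'I_N | val e = nth set0 (lexsets n r) b}.
  have eL : val e \in lexsets n r by rewrite mem_lexsets; apply: (valP e).
  have ltb : (index (val e) (lexsets n r) < N)%N by rewrite -szL index_mem.
  by exists (Ordinal ltb); rewrite nth_index.
have edge (b : 'I_N) : {e : redge n r | val e = nth set0 (lexsets n r) b}.
  have P : #|nth set0 (lexsets n r) b| == r by rewrite -mem_lexsets mem_nth ?szL.
  by exists (exist (fun e : {set 'I_n} => is_true (#|e| == r)) _ P).
have gE e (b b' : 'I_N) : val e = nth set0 (lexsets n r) b -> g e b' = (b' == b)%:R.
  move=> def_e; rewrite /g def_e nth_uniq ?szL ?lexsets_uniq //.
  by rewrite eq_sym val_eqE.
have mulE (x : 'cV[F]_N) a : (Amx v *m x) a 0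
    = equation_lhs v (fun e => \sum_b g e b * x b 0) (nth set0 (row_sets r d) (a %/ d))
        0 (Ordinal (coord_subproof a)).
  rewrite equation_lhs_sum summxE mxE; apply: eq_bigr => b _.
  by rewrite [RHS]mxE mulrC mxE.
have detP : \det (Amx v) != 0 <-> forall x : 'cV[F]_N, Amx v *m x = 0 -> x = 0.
  rewrite -det_tr; split=> [det0 x Ax0|inj].
    apply: contraNeq det0 => x0; apply/det0P; exists x^T.
      by rewrite trmx_eq0.
    by rewrite -trmx_mul Ax0 trmx0.
  apply/det0P=> -[u u0 /(congr1 trmx)]; rewrite trmx_mul trmxK trmx0 => /inj.
  by move/(congr1 trmx)/eqP; rewrite trmxK trmx0 (negPf u0).
apply: iff_trans detP _; split=> [inj lam lam0 e|inj x Ax0].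
  pose x : 'cV[F]_N := \col_b lam (sval (edge b)).
  have lamE e' : lam e' = \sum_b g e' b * x b 0.
    have [b def_e] := idx e'; rewrite (bigD1 b) //= big1 => [|b' neq_b'].
      rewrite addr0 (gE _ _ _ def_e) eqxx mul1r mxE; congr lam.
      by apply: val_inj; rewrite (svalP (edge b)).
    by rewrite (gE _ _ _ def_e) (negPf neq_b') mul0r.
  rewrite lamE (inj x) => [|].
    by rewrite big1 // => b _; rewrite mxE mulr0.
  apply/colP=> a; rewrite mulE mxE.
  have -> : forall M, equation_lhs v (fun e => \sum_b g e b * x b 0) M
      = equation_lhs v lam M.
    by move=> M; apply: eq_bigr => s _; apply: eq_bigr => e' _; rewrite -lamE.
  by rewrite lam0 ?mxE // mem_nth // szR ltn_divLR // [ltnRHS]mulnC.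
pose lam e := \sum_b g e b * x b 0.
have lam0 : lam =1 fun=> 0.
  apply: inj => M MR; apply/rowP=> q; rewrite mxE.
  pose i := index M (row_sets r d).
  (* Coordinate [q] of equation number [i] is row [i * d + q]. *)
  have lt_a : (i * d + q < N)%N.
    apply: (@leq_trans (i.+1 * d)); first by rewrite mulSn addnC ltn_add2r.
    by rewrite mulnC leq_mul2l -szR index_mem MR orbT.
  have := mulE x (Ordinal lt_a); rewrite Ax0 mxE => ->.
  rewrite /= divnMDl // divn_small // addn0 nth_index //; congr (_ _ _).
  by apply: val_inj; rewrite /= modnMDl modn_small.
apply/colP=> b; have [e def_e] := edge b.
have := lam0 e; rewrite /lam (bigD1 b) //= big1 => [|b' neq_b'].
  by rewrite addr0 (gE _ _ _ def_e) eqxx mul1r mxE.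
by rewrite (gE _ _ _ def_e) (negPf neq_b') mul0r.
Qed.

Variable H : 'I_d -> hypergraph n r.
Hypothesis H_part : is_partition H.

Lemma partition_uniq e i j : e \in H i -> e \in H j -> i = j.
Proof.
move=> ei ej; apply/eqP; apply: contraTT ej => neq_ij.
by rewrite (disjointFr (H_part.1 i j neq_ij) ei).
Qed.

(** The factor of [omega] at [e], over any field so that [k] and [F] can be compared. *)
Definition edge_vector (k : fieldType) (e : redge n r) : 'rV[k]_d :=
  if [pick q | e \in H q] is Some q then evec k q else 0.

Lemma edge_vectorE (k : fieldType) e q :
  edge_vector k e 0 q = (e \in H q)%:R.
Proof.
rewrite /edge_vector; case: pickP => [p ep|->]; last by rewrite mxE.
rewrite mxE eqxx /=; congr (_%:R); congr nat_of_bool.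
by apply/eqP/idP => [->//|eq]; apply: partition_uniq eq ep.
Qed.

Definition wt X : nat := \sum_(x in X) x.

(* Rescaling the edge e by the parity of the sum of its vertices turns the
   signs (-1)^(s + j) of the equations into those of the simplicial boundary. *)
Definition color_chain lam q X : F :=
  (-1) ^+ wt X * \sum_(e | (val e == X) && (e \in H q)) lam e.

Lemma color_chain_val lam q (e : redge n r) :
  color_chain lam q (val e) = (-1) ^+ wt (val e) * (lam e *+ (e \in H q)).
Proof.
rewrite /color_chain; congr (_ * _); rewrite big_mkcondr /=.
by rewrite (big_pred1 e) => [|e']; rewrite ?val_eqE //; case: (e \in H q).
Qed.

Lemma color_chain_supp lam q X : X \notin supports (H q) -> color_chain lam q X = 0.
Proof.
move=> XH; rewrite /color_chain big_pred0 ?mulr0 // => e.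
by apply: contraNF XH => /andP[/eqP<-]; apply: imset_f.
Qed.

(** Since [wt (s |: M)] is [s + wt M], the two signs with [wt M] cancel and leave the sign of the
    equation. *)
Lemma equation_lhs_bd lam M q :
  equation_lhs (edge_vector F) lam M 0 q = (-1) ^+ wt M * bd (color_chain lam q) M.
Proof.
rewrite summxE mulr_sumr; apply: eq_bigr => s sM; rewrite summxE /color_chain.
have -> : wt (s |: M) = (s + wt M)%N by rewrite /wt big_setU1.
have sgnE x : (-1) ^+ wt M * ((-1) ^+ below M s * ((-1) ^+ (s + wt M) * x))
    = (-1) ^+ (s + below M s) * x :> F.
  rewrite !mulrA -!exprD -signr_odd -[in RHS]signr_odd; congr ((-1) ^+ _ * _).
  by rewrite !oddD; case: (odd (wt M)); case: (odd s); case: (odd _).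
rewrite sgnE mulr_sumr.
rewrite [RHS]big_mkcondr; apply: eq_bigr => e _; rewrite mxE edge_vectorE.
by case: ifP; rewrite ?mulr1 ?mulr0.
Qed.

Lemma det_omega_neq0 : \det (Amx (edge_vector F)) != 0 <->
  (forall q, top_injective F (H q)).
Proof.
have n_gt0 : (0 < n)%N by rewrite muln_gt0 r_gt0.
have lt_last : (n.-1 < n)%N by rewrite prednK.
pose last := Ordinal lt_last.
(* Ordinals start at 0, so [m.+1 < n] excludes exactly the last vertex. *)
have mem_rows M : (M \in row_sets r d) = (M \in [set M in draws n r.-1 | last \notin M]).
  rewrite mem_filter mem_lexsets !inE andbC; congr (_ && _).
  apply/forall_inP/idP => [ltM|lastM m mM].
    by apply/negP=> /ltM /=; rewrite prednK ?ltnn.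
  rewrite -[X in (_ < X)%N](prednK n_gt0) ltnS ltn_neqAle -ltnS prednK // ltn_ord andbT.
  by apply: contraNneq lastM => eq_m; rewrite (_ : last = m) //; apply: val_inj.
apply: iff_trans (det_Amx_neq0 _) _; split=> [inj q c cH c0|inj lam lam0 e].
  (* Undoing the sign twist and putting zero on the other colors turns a cycle on [H q] into a
     solution. *)
  pose lam e := (-1) ^+ wt (val e) * c (val e) *+ (e \in H q).
  have chainE p X : color_chain lam p X = if p == q then c X else 0.
    have [XH|XH] := boolP (X \in supports (H p)); last first.
      by rewrite color_chain_supp //; case: eqP XH => // -> /cH.
    have [e ep ->] := imsetP XH.
    rewrite color_chain_val ep /lam; case: eqVneq ep => [->|neq_pq] ep.
      by rewrite ep mulr1n mulrA -exprD addnn -mul2n exprM sqrrN !expr1n mul1r.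
    rewrite (_ : (e \in H q) = false) ?mulr0 //.
    by apply: contraNF neq_pq => /(partition_uniq ep)/eqP.
  have /inj lam0 : forall M, M \in row_sets r d -> equation_lhs (edge_vector F) lam M = 0.
    move=> M; rewrite mem_rows inE => /andP[MQ _].
    apply/rowP=> p; rewrite equation_lhs_bd mxE.
    rewrite (_ : bd _ M = if p == q then bd c M else 0).
      by case: eqP; rewrite ?c0 ?mulr0.
    rewrite /bd; case: eqP => [->|/eqP/negPf neq_pq].
      by apply: eq_bigr => s _; rewrite chainE eqxx.
    by rewrite big1 // => s _; rewrite chainE neq_pq mulr0.
  move=> X; have := chainE q X; rewrite eqxx => <-.
  by rewrite /color_chain big1 ?mulr0.
have /bigcupP[q _ eq] : e \in \bigcup_i H i by rewrite H_part.2 in_setT.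
have /(_ (val e))/eqP : color_chain lam q =1 fun=> 0.
  apply: (top_injective_off (v := last) (inj q)) => [X|M]; first exact: color_chain_supp.
  rewrite -mem_rows => /lam0/rowP/(_ q)/eqP; rewrite equation_lhs_bd mxE.
  by rewrite mulf_eq0 signr_eq0 => /eqP.
by rewrite color_chain_val eq mulf_eq0 signr_eq0 => /eqP.
Qed.

End Determinant.

(** * Change of field, and the equivalence *)

Definition omega_mx r d (H : 'I_d -> hypergraph (r * d) r)
    : 'M[int]_(d * 'C((r * d).-1, r.-1)) :=
  \matrix_(a, b) let M := nth set0 (row_sets r d) (a %/ d) in
    \sum_(s | s \notin M) \sum_(e : redge (r * d) r | val e == s |: M)
      (-1) ^+ (s + below M s) * (val e == nth set0 (lexsets (r * d) r) b)%:R
      * (e \in H (Ordinal (coord_subproof a)))%:R.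

Lemma det_edge_vector (k : fieldType) r d (H : 'I_d -> hypergraph (r * d) r) :
  is_partition H -> \det (Amx (edge_vector H k)) = (\det (omega_mx H))%:~R.
Proof.
move=> H_part; rewrite -det_map_mx; congr (\det _); apply/matrixP=> a b.
rewrite !mxE summxE rmorph_sum; apply: eq_bigr => s _.
rewrite summxE rmorph_sum; apply: eq_bigr => e _.
by rewrite mxE edge_vectorE // !rmorphM rmorph_sign !rmorph_nat.
Qed.

Lemma pchar0_intr_eq0 (k : fieldType) (z : int) :
  [pchar k] =i pred0 -> (z%:~R == 0 :> k) = (z == 0).
Proof.
move=> char_k; case: z => m; first exact: (pcharf0P k).1.
by rewrite NegzE rmorphN oppr_eq0; apply: (pcharf0P k).1.
Qed.

Theorem theorem5p14 (k : fieldType) (char_k : [pchar k] =i pred0)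
    (F : fieldType) (char_F : [pchar F] =i pred0)
    (r d : nat) (r_ge2 : (2 <= r)%N) (d_ge2 : (2 <= d)%N)
    (H : 'I_d -> hypergraph (r * d) r) (H_part : is_partition H) :
  [<-> detS (omega k H) <> 0;
       pre_homogeneous H /\
         (forall (i : 'I_d) (q : int),
            -1 <= q <= r%:Z - 1 -> betti F (H i) q = 0%N);
       pre_homogeneous H /\
         (forall i : 'I_d, betti F (H i) (r%:Z - 1) = 0%N)].
Proof.
have r_gt0 := ltnW r_ge2; have d_gt0 := ltnW d_ge2.
have n_gt0 : (0 < r * d)%N by rewrite muln_gt0 r_gt0.
have lt_rn : (r.-1 < r * d)%N by rewrite prednK ?leq_pmulr.
(* The left side is over [k] and the right side over [F]; the integer determinant links them. *)
have detP : detS (omega k H) <> 0 <-> forall i, top_injective F (H i).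
  rewrite /omega detS_simple_tensor //.
  apply: iff_trans (det_omega_neq0 F _ _ H_part) => //.
  rewrite (det_edge_vector F) // pchar0_intr_eq0 // -(pchar0_intr_eq0 _ char_k).
  by rewrite -(det_edge_vector k) //; split=> /eqP.
tfae.
- move=> /detP inj.
  have le_card i : (#|H i| <= 'C((r * d).-1, r.-1))%N.
    by apply: top_injective_card (inj i); apply: Ordinal n_gt0.
  (* The [H i] cover all edges. *)
  have sum_card : ('C(r * d, r) <= \sum_i #|H i|)%N.
    rewrite -[in 'C(_, r)](card_ord (r * d)) -card_draws cardsE -card_sig -cardsT.
    rewrite -H_part.2.
    apply: (big_ind2 (fun (A : hypergraph (r * d) r) m => #|A| <= m)%N) => //.
      by rewrite cards0.
    by move=> A a B b leA leB; apply: leq_trans (leq_card_setU A B) (leq_add leA leB).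
  (* The d upper bounds add up to ['C(r * d, r)], so each of them is attained. *)
  have [_] := leqif_sum (fun i (_ : xpredT i) => leqif_eq (le_card i)).
  rewrite sum_nat_const card_ord bin_block // eqn_leq sum_card andbT.
  have -> : (\sum_i #|H i| <= 'C(r * d, r))%N.
    apply: (@leq_trans (\sum_(i < d) 'C((r * d).-1, r.-1))); first exact: leq_sum.
    by rewrite sum_nat_const card_ord bin_block.
  move=> /esym/forall_inP eqH.
  have cardH i : #|H i| = 'C((r * d).-1, r.-1) by apply/eqP/eqH.
  split=> [i s /andP[s_gt0 le_sr]|i q /andP[_ le_qr]].
    rewrite (top_injective_full lt_rn (inj i) (cardH i)) ?card_draws ?card_ord //.
    by rewrite -(prednK r_gt0) ltnS.
  exact: (betti_full lt_rn).
- by case=> pH b0; split=> // i; apply: b0; rewrite lexx andbT lerBrDr addNr.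
- by case=> _ b0; apply/detP=> i; apply/betti_top.
Qed.
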